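(* Assume $r\ge2$, let $\eta:[0,\infty)\to[0,\infty)$ be a homeomorphism and let $F:(\mathbb{R}^n,D)\to(\mathbb{R}^n,D)$ be an $\eta$-quasisymmetric homeomorphism. Then $F$ is a $K$-quasisimilarity with $K=(\eta(1)/\eta^{-1}(1))^{2r+2}$, i.e. there is $C>0$ with $\frac{C}{K}D(x,y)\le D(F(x),F(y))\le CK\,D(x,y)$ for all $x,y\in\mathbb{R}^n$.
   Context: Let $n_1,\dots,n_r\ge1$, $n=n_1+\dots+n_r$, $\mathbb{R}^n=\mathbb{R}^{n_1}\times\dots\times\mathbb{R}^{n_r}$, and $0<\alpha_1<\dots<\alpha_r$. For $x=(x_1,\dots,x_r)$, $y=(y_1,\dots,y_r)$ with $x_i,y_i\in\mathbb{R}^{n_i}$, $D(x,y)=\max\{|x_1-y_1|,|x_2-y_2|^{\alpha_1/\alpha_2},\dots,|x_r-y_r|^{\alpha_1/\alpha_r}\}$, $|\cdot|$ the Euclidean norm; $D$ is a metric. A homeomorphism $f$ between metric spaces is $\eta$-quasisymmetric if $\frac{d(f(x),f(y))}{d(f(x),f(z))}\le\eta\big(\frac{d(x,y)}{d(x,z)}\big)$ for all distinct $x,y,z$. For $K\ge1$, $C>0$, a bijection $F$ is a $K$-quasisimilarity with constant $C$ if $\frac CK d(x,y)\le d(F(x),F(y))\le CK\,d(x,y)$ for all $x,y$. *)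

(* Defs.v *)
From HB Require Import structures.
From mathcomp Require Import all_boot all_order all_algebra.
From mathcomp Require Import all_classical all_reals all_analysis.
Set Implicit Arguments. Unset Strict Implicit. Unset Printing Implicit Defensive.
Import Order.TTheory GRing.Theory Num.Theory.
Import numFieldNormedType.Exports.
Local Open Scope ring_scope.
Local Open Scope classical_set_scope.

(* A point of R^n = R^{n_1} x ... x R^{n_r}; blocks indexed by i : 'I_r,
   block i lives in R^{ns i}. *)
Definition Pt (R : realType) (r : nat) (ns : nat -> nat) :=
  forall i : 'I_r, 'rV[R]_(ns i).

Definition eucl (R : realType) (m : nat) (v : 'rV[R]_m) : R :=
  Num.sqrt (\sum_(j < m) (v ord0 j) ^+ 2).

(* D(x,y) = max_i |x_i - y_i|^(alpha_1/alpha_i)  (alpha indexed from 0) *)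
Definition Dmet (R : realType) (r : nat) (ns : nat -> nat) (alpha : nat -> R)
  (x y : Pt R r ns) : R :=
  \big[Num.max/0]_(i < r) ((eucl (x i - y i)) `^ (alpha 0%N / alpha i)).

Definition dcontinuous (T : Type) (R : realType) (d : T -> T -> R)
  (f : T -> T) : Prop :=
  forall x (e : R), 0 < e -> exists2 del : R, 0 < del &
    forall y, d x y < del -> d (f x) (f y) < e.

Definition dhomeo (T : Type) (R : realType) (d : T -> T -> R) (f : T -> T) : Prop :=
  exists g : T -> T, [/\ cancel f g, cancel g f, dcontinuous d f & dcontinuous d g].

Definition quasisym (T : Type) (R : realType) (d : T -> T -> R)
  (eta : R -> R) (f : T -> T) : Prop :=
  dhomeo d f /\
  forall x y z, x <> y -> x <> z -> y <> z ->
    d (f x) (f y) / d (f x) (f z) <= eta (d x y / d x z).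

Definition halfline (R : realType) : set R := `[0, +oo[%classic.

Definition homeo_halfline (R : realType) (eta etainv : R -> R) : Prop :=
  (forall t, 0 <= t -> 0 <= eta t) /\
  [/\ (forall t, 0 <= t -> 0 <= etainv t),
      (forall t, 0 <= t -> etainv (eta t) = t),
      (forall t, 0 <= t -> eta (etainv t) = t),
      {within (@halfline R), continuous eta} &
      {within (@halfline R), continuous etainv}].

Definition quasisim (T : Type) (R : realType) (d : T -> T -> R) (K C : R)
  (f : T -> T) : Prop :=
  (forall x y, C / K * d x y <= d (f x) (f y)) /\
  (forall x y, d (f x) (f y) <= C * K * d x y) /\ bijective f.

(* Main.v *)
Require Import Defs.
From HB Require Import structures.
From mathcomp Require Import all_boot all_order all_algebra.
From mathcomp Require Import all_classical all_reals all_analysis.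
From mathcomp Require Import lra ring.
Set Implicit Arguments. Unset Strict Implicit. Unset Printing Implicit Defensive.
Import Order.TTheory GRing.Theory Num.Theory.
Local Open Scope ring_scope.

(** The fibres [R^{n_1} * {pt}] ("leaves") carry the only directions in which [D] is not
    snowflaked.  A quasisymmetric map [F] sends leaves to leaves: take a grid of mesh
    [e = l/N] around a segment of a leaf, and let [d] be the [D]-displacement under [F] of
    one step along the leaf.  The images contain disjoint boxes of size about [d], so
    [sum d^Q] stays bounded, [Q] being the homogeneous dimension; there are about [N^(Q-1)]
    lines of [N] steps, and [d^b <= N^(-b) + N^(Q-b) d^Q], so the average over the lines of
    [sum d^b] is [O(N^(1-b))].  For a block of exponent [b = alpha_i/alpha_1 > 1] this
    average dominates the variation of that block of [F] along the segment, which hence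
    vanishes.

    On a leaf, a displacement of length at most [t] is compared with the height of a
    parallel leaf at distance [t]; as leaves are equidistant, images of displacements of
    equal length in a leaf agree up to [eta(1)^3].  Subdividing long segments, both for [F]
    and for [F^-1], makes [F] linear on leaves up to [(eta(1)/eta^-1(1))^3], with the same
    slope on all leaves since the images of long parallel segments differ by a bounded
    amount.  Rotating an arbitrary pair onto a leaf costs one more factor [eta(1)]. *)

(** * Counting lattice points and packing boxes *)

(** With [t] and [s] the integer parts of [y] and [l], the integers from [t + 1] to [t + s - 1] lie
    in the interval; there are more than [l - 2 >= l / 2] of them. *)
Lemma card_lattice_interval (R : realType) (P : nat) (y l : R) :
  0 <= y -> 4 <= l -> y + l <= P%:R ->
  l / 2 <= #|[pred v : 'I_P | y <= v%:R <= y + l]|%:R.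
Proof.
move=> y0 l4 ylP.
have l0 : 0 <= l by lra.
have /andP[ty1 ty2] := truncn_itv y0.
have /andP[tl1 tl2] := truncn_itv l0.
set t := Num.truncn y in ty1 ty2; set s := Num.truncn l in tl1 tl2.
rewrite -(natr1 t) in ty2; rewrite -(natr1 s) in tl2.
have s2 : (2 <= s)%N.
  by rewrite -(ler_nat R); have : (2%:R : R) = 2 by []; lra.
have ts_lt (i : 'I_(s.-1)) : (t.+1 + i < P)%N.
  have : (t.+1 + i <= t + s.-1)%N by rewrite addSnnS leq_add2l.
  move=> h; rewrite -(ltr_nat R).
  have : (t.+1 + i)%:R <= (t + s.-1)%:R :> R by rewrite ler_nat.
  have : (s.-1)%:R + 1 = s%:R :> R by rewrite natr1 prednK // (leq_trans _ s2).
  rewrite [(t + _)%:R]natrD; lra.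
pose f (i : 'I_(s.-1)) : 'I_P := Ordinal (ts_lt i).
have finj : injective f.
  by move=> i j /(congr1 val) /= /addnI ij; apply: val_inj.
have := card_imset [set: 'I_(s.-1)] finj.
rewrite cardsT card_ord => cf.
have fsub : [set f x | x in [set: 'I_(s.-1)]] \subset
    [set v : 'I_P | y <= v%:R <= y + l].
  apply/fintype.subsetP => v /imsetP[i _ ->]; rewrite inE /=.
  have : (t.+1 + i <= t + s.-1)%N by rewrite addSnnS leq_add2l.
  rewrite -(ler_nat R) natrD => h1.
  have : (s.-1)%:R + 1 = s%:R :> R by rewrite natr1 prednK // (leq_trans _ s2).
  have : t.+1%:R <= (t.+1 + i)%:R :> R by rewrite ler_nat leq_addr.
  move: h1; rewrite [(t + _)%:R]natrD -(natr1 t); lra.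
have : (s.-1)%:R <= #|[pred v : 'I_P | y <= v%:R <= y + l]|%:R :> R.
  rewrite ler_nat.
  by have := subset_leq_card fsub; rewrite cf cardsE.
have : (s.-1)%:R + 1 = s%:R :> R by rewrite natr1 prednK // (leq_trans _ s2).
lra.
Qed.

Lemma leq_card_disjoint_family (T J : finType) (S : J -> {set T}) :
  (forall i j, i != j -> [disjoint S i & S j]) ->
  (\sum_j #|S j| <= #|T|)%N.
Proof.
move=> dis.
under eq_bigr => j _ do rewrite -sum1_card.
rewrite (exchange_big_dep xpredT) //= -sum1_card.
apply: leq_sum => x _; rewrite sum1_card.
apply/card_le1_eqP => i j xi xj; apply/eqP/negP => /negP /dis.
by move=> /pred0P /(_ x) /=; rewrite (xi : x \in S i) (xj : x \in S j).
Qed.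

(* Counting the points of a fine product lattice plays the role of volume. *)
Lemma box_packing (R : realType) (I J : finType) (ctr rad : J -> I -> R)
    (o b : I -> R) :
  (forall j k, 0 < rad j k) -> (forall k, 0 < b k) ->
  (forall i j (z : I -> R), (forall k, `|z k - ctr i k| <= rad i k) ->
     (forall k, `|z k - ctr j k| <= rad j k) -> i = j) ->
  (forall j (z : I -> R), (forall k, `|z k - ctr j k| <= rad j k) ->
     forall k, `|z k - o k| <= b k) ->
  \sum_j \prod_k (rad j k) <= 2 ^+ #|I| * \prod_k b k.
Proof.
move=> rad0 b0 dis bnd.
pose B := \sum_j \sum_k (4 * b k / rad j k).
have term0 j k : 0 <= 4 * b k / rad j k.
  by apply: divr_ge0; [have := b0 k; lra | exact: ltW].
have Bge j k : 4 * b k / rad j k <= B.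
  rewrite /B (bigD1 j) //= (bigD1 k) //= -addrA lerDl addr_ge0 //.
    by apply: sumr_ge0.
  by apply: sumr_ge0 => ? _; apply: sumr_ge0.
(* The lattice has [P] points per axis; [P > B] makes every side of every small box at least four
   mesh widths long. *)
pose P := (Num.truncn B).+1.
have P0 : 0 < P%:R :> R by rewrite ltr0n.
have BP : B < P%:R by exact: truncnS_gt.
pose z (u : {ffun I -> 'I_P}) k := o k - b k + 2 * b k / P%:R * (u k)%:R.
pose S j : {set {ffun I -> 'I_P}} :=
  [set u : {ffun I -> 'I_P} | [forall k, `|z u k - ctr j k| <= rad j k]].
have Sdis i j : i != j -> [disjoint S i & S j].
  move=> ij; apply/pred0P => u /=; apply/negP; rewrite !inE.
  move=> /andP[/forallP ui /forallP uj].
  by move/eqP: ij; apply; exact: (dis _ _ (z u)).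
have SleT := leq_card_disjoint_family Sdis.
rewrite card_ffun card_ord in SleT.
have Scard j : \prod_k (rad j k * P%:R / b k / 2) <= #|S j|%:R.
  pose Fj k := [pred v : 'I_P |
    `|o k - b k + 2 * b k / P%:R * v%:R - ctr j k| <= rad j k].
  have -> : #|S j| = #|(family Fj : simpl_pred {ffun I -> 'I_P})|.
    by apply: eq_card => u; rewrite inE; apply/forallP/familyP => h k; have := h k.
  rewrite card_family foldrE big_map big_enum /= natr_prod.
  apply: ler_prod => k _; apply/andP; split.
    by rewrite !divr_ge0 ?mulr_ge0 // ltW.
  (* Lower end and length of side [k] of box [j] in units of the mesh [2 * b k / P], measured from
     the lower end of the bounding box. *)
  pose y := (ctr j k - rad j k - o k + b k) * P%:R / (2 * b k).
  pose l := rad j k * P%:R / b k.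
  have bk := b0 k; have rk := rad0 j k.
  have up : `|ctr j k + rad j k - o k| <= b k.
    apply: (bnd j (fun k => ctr j k + rad j k)) => i.
    by rewrite addrC addKr ger0_norm // ltW.
  have dn : `|ctr j k - rad j k - o k| <= b k.
    apply: (bnd j (fun k => ctr j k - rad j k)) => i.
    by rewrite addrC addKr normrN ger0_norm // ltW.
  have y0 : 0 <= y.
    apply: divr_ge0; last lra.
    by rewrite mulr_ge0 ?(ltW P0) //; move: dn; rewrite ler_norml; lra.
  have l4 : 4 <= l.
    have := le_lt_trans (Bge j k) BP.
    rewrite ltr_pdivrMr // /l ler_pdivlMr // mulrC [P%:R * _]mulrC; lra.
  have ylP : y + l <= P%:R.
    have -> : y + l = P%:R * ((ctr j k + rad j k - o k + b k) / (2 * b k)).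
      by rewrite /y /l; field; rewrite gt_eqF.
    rewrite ger_pMr // ler_pdivrMr; last lra.
    by move: up; rewrite ler_norml; lra.
  apply: le_trans (card_lattice_interval y0 l4 ylP) _.
  rewrite ler_nat; apply: subset_leq_card; apply/fintype.subsetP => v.
  rewrite !inE => /andP[yv vl].
  have e1 : 2 * b k / P%:R * y = ctr j k - rad j k - o k + b k.
    by rewrite /y; field; rewrite !gt_eqF.
  have e2 : 2 * b k / P%:R * l = 2 * rad j k.
    by rewrite /l; field; rewrite !gt_eqF.
  have c0 : 0 < 2 * b k / P%:R by rewrite divr_gt0 // mulr_gt0.
  move: yv vl; rewrite -(ler_pM2l c0) e1 -(ler_pM2l c0 v%:R) mulrDr e1 e2.
  rewrite /Fj unfold_in /= ler_norml; lra.
have PI : 0 < (P%:R ^+ #|I| : R) by rewrite exprn_gt0.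
have tot : \sum_j \prod_k (rad j k * P%:R / b k / 2) <= P%:R ^+ #|I|.
  rewrite -natrX; apply: le_trans (_ : (\sum_j #|S j|)%:R <= _).
    by rewrite natr_sum; apply: ler_sum.
  by rewrite ler_nat.
have b_gt0 : 0 < \prod_k b k by apply: prodr_gt0.
rewrite -(ler_pM2r (_ : 0 < P%:R ^+ #|I| / (2 ^+ #|I| * \prod_k b k))); last first.
  by rewrite divr_gt0 // mulr_gt0 // exprn_gt0.
rewrite [leRHS]mulrC divfK; last by rewrite mulf_neq0 ?gt_eqF // exprn_gt0.
apply: le_trans tot; rewrite mulr_suml; apply: ler_sum => j _.
rewrite -!prodr_const -big_split /= -prodf_div -big_split /=.
apply: ler_prod => k _; have bk := b0 k; have rk := rad0 j k.
have -> : rad j k * (P%:R / (2 * b k)) = rad j k * P%:R / b k / 2.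
  by field; rewrite gt_eqF.
by rewrite lexx andbT !divr_ge0 ?mulr_ge0 // ltW.
Qed.

(** * The Euclidean norm of row vectors *)

Section Euclidean.
Context {R : realType}.

Lemma eucl_ge0 m (v : 'rV[R]_m) : 0 <= eucl v.
Proof. exact: sqrtr_ge0. Qed.

Lemma sum_sqr_ge0 m (v : 'rV[R]_m) : 0 <= \sum_(j < m) (v ord0 j) ^+ 2.
Proof. by apply: sumr_ge0 => j _; apply: sqr_ge0. Qed.

Lemma sqr_eucl m (v : 'rV[R]_m) : eucl v ^+ 2 = \sum_(j < m) (v ord0 j) ^+ 2.
Proof. by rewrite sqr_sqrtr // sum_sqr_ge0. Qed.

Lemma norm_coord_le_eucl m (v : 'rV[R]_m) j : `|v ord0 j| <= eucl v.
Proof.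
rewrite -sqrtr_sqr ler_sqrt ?sum_sqr_ge0 // (bigD1 j) //= lerDl.
by apply: sumr_ge0 => i _; apply: sqr_ge0.
Qed.

Lemma eucl_eq0 m (v : 'rV[R]_m) : eucl v = 0 -> v = 0.
Proof.
move=> v0; apply/rowP => j; rewrite mxE.
by apply/eqP; rewrite -normr_le0 -v0 norm_coord_le_eucl.
Qed.

Lemma eucl0 m : eucl (0 : 'rV[R]_m) = 0.
Proof.
by rewrite /eucl big1 ?sqrtr0 // => j _; rewrite mxE expr0n.
Qed.

Lemma euclZ m a (v : 'rV[R]_m) : eucl (a *: v) = `|a| * eucl v.
Proof.
rewrite /eucl -sqrtr_sqr -sqrtrM ?sqr_ge0 // mulr_sumr.
by congr Num.sqrt; apply: eq_bigr => j _; rewrite mxE exprMn.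
Qed.

Lemma euclN m (v : 'rV[R]_m) : eucl (- v) = eucl v.
Proof. by rewrite -scaleN1r euclZ normrN1 mul1r. Qed.

(* Weighted AM-GM: [(a + b)^2 <= (1 + B/A) a^2 + (1 + A/B) b^2] for each coordinate,
   with [A], [B] the two norms. *)
Lemma euclD m (u v : 'rV[R]_m) : eucl (u + v) <= eucl u + eucl v.
Proof.
have [/eucl_eq0 -> | u0] := eqVneq (eucl u) 0; first by rewrite add0r eucl0 add0r.
have [/eucl_eq0 -> | v0] := eqVneq (eucl v) 0; first by rewrite addr0 eucl0 addr0.
have up : 0 < eucl u by rewrite lt_def u0 eucl_ge0.
have vp : 0 < eucl v by rewrite lt_def v0 eucl_ge0.
have uv : 0 <= eucl u + eucl v by rewrite addr_ge0 ?eucl_ge0.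
rewrite -(ler_pXn2r (ltn0Sn 1)) ?nnegrE ?eucl_ge0 // sqr_eucl.
set A := eucl u in u0 up uv *; set B := eucl v in v0 vp uv *.
have -> : (A + B) ^+ 2 = (1 + B / A) * A ^+ 2 + (1 + A / B) * B ^+ 2.
  by field; apply/andP; split.
rewrite {2}/A {3}/B !sqr_eucl !mulr_sumr -big_split /=.
apply: ler_sum => j _; rewrite mxE; set a := u _ _; set b := v _ _.
rewrite -subr_ge0.
have -> : (1 + B / A) * a ^+ 2 + (1 + A / B) * b ^+ 2 - (a + b) ^+ 2 =
          (B * a - A * b) ^+ 2 / (A * B).
  by field; apply/andP; split.
by rewrite divr_ge0 ?sqr_ge0 // mulr_ge0 ?ltW.
Qed.

Lemma eucl_le_sum m (v : 'rV[R]_m) : eucl v <= \sum_j `|v ord0 j|.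
Proof.
have s0 : 0 <= \sum_j `|v ord0 j| by apply: sumr_ge0.
rewrite -(ler_pXn2r (ltn0Sn 1)) ?nnegrE ?eucl_ge0 // sqr_eucl expr2.
rewrite mulr_suml; apply: ler_sum => j _.
rewrite -real_normK ?num_real // expr2 ler_wpM2l //.
by rewrite (bigD1 j) //= lerDl sumr_ge0.
Qed.

(** Comparing [j] with [0] in [nat] avoids a hypothesis [0 < m]; for [m = 0] the row is empty. *)
Definition unit_row m : 'rV[R]_m := \row_j (j == 0%N :> nat)%:R.

Lemma eucl_unit_row m : (0 < m)%N -> eucl (unit_row m) = 1.
Proof.
case: m => // m _; rewrite /eucl (bigD1 ord0) //= big1 ?addr0.
  by rewrite mxE eqxx expr1n sqrtr1.
by move=> j j0; rewrite mxE -[_ == _ :> nat]/(j == ord0) (negPf j0) expr0n.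
Qed.

End Euclidean.

(** * Real powers and rounding *)

Section RealInequalities.
Context {R : realType}.

(** A number in [(0, 1]] is at most its power [g <= 1]; apply this to [a / (a + b)] and
    [b / (a + b)], whose sum is one. *)
Lemma powR_subadditive (a b g : R) : 0 <= a -> 0 <= b -> 0 < g <= 1 ->
  (a + b) `^ g <= a `^ g + b `^ g.
Proof.
move=> a0 b0 /andP[g0 g1].
have [ab0|abn0] := eqVneq (a + b) 0.
  by rewrite ab0 powR0 ?gt_eqF // addr_ge0 // powR_ge0.
have ab : 0 < a + b by rewrite lt_def abn0 addr_ge0.
have le_frac c : 0 <= c <= a + b -> c / (a + b) * (a + b) `^ g <= c `^ g.
  move=> /andP[c0 cab]; have [->|cn0] := eqVneq c 0.
    by rewrite !mul0r powR0 ?gt_eqF.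
  have cp : 0 < c by rewrite lt_def cn0.
  rewrite -[in leRHS](divfK abn0 c) powRM //; last 2 first.
    by rewrite divr_ge0 // ltW.
    exact: ltW.
  rewrite ler_wpM2r ?powR_ge0 // ger1_powR //.
  by rewrite divr_gt0 //= ler_pdivrMr // mul1r.
have ha := le_frac a; have hb := le_frac b.
have -> : (a + b) `^ g = a / (a + b) * (a + b) `^ g + b / (a + b) * (a + b) `^ g.
  by rewrite -mulrDl -mulrDl divff // mul1r.
apply: lerD; [apply: ha | apply: hb]; lra.
Qed.

Lemma le_powR2l (a b g : R) : 0 <= g -> 0 <= a -> a <= b -> a `^ g <= b `^ g.
Proof.
move=> g0 a0 ab; apply: ge0_ler_powR => //; rewrite nnegrE //.
exact: le_trans ab.
Qed.

Lemma powRKV (a g : R) : 0 < g -> 0 <= a -> (a `^ g) `^ g^-1 = a.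
Proof. by move=> g0 a0; rewrite -powRrM divff ?gt_eqF // powRr1. Qed.

Lemma powRVK (a g : R) : 0 < g -> 0 <= a -> (a `^ g^-1) `^ g = a.
Proof. by move=> g0 a0; rewrite -powRrM mulVf ?gt_eqF // powRr1. Qed.

Lemma ceil_quotient (s t : R) : 0 <= s -> 0 < t ->
  exists2 N : nat, s <= N%:R * t & N%:R * t <= s + t.
Proof.
move=> s0 t0; have /andP[] := truncn_itv (divr_ge0 s0 (ltW t0)).
set n := Num.truncn _ => le_n lt_n; exists n.+1.
  by move: lt_n; rewrite ltr_pdivrMr // => /ltW.
by move: le_n; rewrite ler_pdivlMr // -natr1; nra.
Qed.

(** The errors [s1], [t2], [c] stay fixed while [T] grows: eliminating [S] and [S'] bounds [T] times
    the supposed positive gap by the constant [m]. *)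
Lemma linear_comparison (s1 t1 s2 t2 E E' c : R) :
  0 <= s1 -> 0 <= t1 -> 0 <= s2 -> 0 <= t2 -> 0 <= E -> 0 <= E' -> 0 <= c ->
  (forall T, 0 <= T -> exists S S' : R, [/\ T * s1 <= E' * t1 * (S + s1),
     S' * t2 <= E * s2 * (T + t2) & S <= S' + c]) ->
  s1 * t2 <= E * E' * t1 * s2.
Proof.
move=> s1p t1p s2p t2p E0 E0' c0 long; rewrite leNgt; apply/negP => lt.
pose m := E' * t1 * (E * s2 * t2 + (c + s1) * t2).
have w : 0 <= E' * t1 by rewrite mulr_ge0.
have m0 : 0 <= m.
  by apply: mulr_ge0 => //; rewrite addr_ge0 ?mulr_ge0 ?addr_ge0.
have d0 : 0 < s1 * t2 - E * E' * t1 * s2 by rewrite subr_gt0.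
pose T := (m + 1) / (s1 * t2 - E * E' * t1 * s2).
have T0 : 0 <= T by apply: divr_ge0; [exact: addr_ge0 | exact: ltW].
have TE : T * (s1 * t2 - E * E' * t1 * s2) = m + 1 by rewrite /T divfK // gt_eqF.
have [S [S' [h1 h2 h3]]] := long T T0.
have k1 := ler_wpM2r t2p h1.
have k3 := ler_wpM2l w (ler_wpM2r t2p h3).
have k2 := ler_wpM2l w h2.
rewrite /m in TE; lra.
Qed.

Lemma powR_sum (J : finType) (P : pred J) (f : J -> R) (x : R) : 0 < x ->
  x `^ (\sum_(j | P j) f j) = \prod_(j | P j) x `^ f j.
Proof.
move=> x0; apply: (big_morph (powR x)); last exact: powRr0.
by move=> a b; rewrite powRD //; apply/implyP => _; rewrite gt_eqF.
Qed.

(** Taken at [x = N * d] and divided by [N^a], this is the interpolation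
    [d^a <= N^(-a) + N^(b-a) * d^b]. *)
Lemma powR_le_1D (x a b : R) : 0 <= x -> 0 <= a -> a <= b ->
  x `^ a <= 1 + x `^ b.
Proof.
move=> x0 a0 ab; have [x1|x1] := leP x 1.
  apply: le_trans (le_powR2l a0 x0 x1) _.
  by rewrite powR1 lerDl powR_ge0.
by apply: le_trans (ler_powR (ltW x1) ab) _; rewrite lerDr.
Qed.

Lemma nat_close (m n : nat) (e : R) : 0 < e -> `|m%:R * e - n%:R * e| < e -> m = n.
Proof.
move=> e0; rewrite -mulrBl normrM (gtr0_norm e0) gtr_pMl // ltr_norml.
move=> /andP[h1 h2].
by case: (ltngtP m n) => // h; exfalso; move: h; rewrite -(ler_nat R) -natr1; lra.
Qed.

End RealInequalities.

(** * The metric [D], its leaves and the segments in them *)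

Section Main.
Context {R : realType} {r : nat} {ns : nat -> nat} {alpha : nat -> R}.
Hypothesis r_ge2 : (2 <= r)%N.
Hypothesis ns_ge1 : forall i, (i < r)%N -> (1 <= ns i)%N.
Hypothesis alpha0_gt0 : 0 < alpha 0%N.
Hypothesis alpha_incr : forall i j, (i < j)%N -> (j < r)%N -> alpha i < alpha j.

Local Notation X := (Pt R r ns).

(* Locked, so that conversion never unfolds the metric when comparing distances. *)
Definition dist : X -> X -> R := locked (@Dmet R r ns alpha).
Local Notation D := dist.

Lemma distE : dist = @Dmet R r ns alpha.
Proof. by rewrite /dist -lock. Qed.

(** Reciprocal of the exponent of block [i] in [Dmet]: a [D]-ball of radius [s] has Euclidean radius
    [s^beta] in that block. *)
Definition beta (i : nat) : R := alpha i / alpha 0%N.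

Let i0 : 'I_r := Ordinal (ltnW r_ge2).
Let i1 : 'I_r := Ordinal r_ge2.

Lemma beta0 : beta 0 = 1.
Proof. by rewrite /beta divff ?gt_eqF. Qed.

Lemma beta_gt1 (i : 'I_r) : (0 < i)%N -> 1 < beta i.
Proof. by move=> i_gt0; rewrite ltr_pdivlMr // mul1r alpha_incr. Qed.

Lemma beta_ge1 (i : 'I_r) : 1 <= beta i.
Proof.
have [i_gt0|] := ltnP 0 i; first by rewrite ltW // beta_gt1.
by rewrite leqn0 => /eqP ->; rewrite beta0.
Qed.

Lemma beta_gt0 (i : 'I_r) : 0 < beta i.
Proof. exact: lt_le_trans ltr01 (beta_ge1 i). Qed.

Lemma betaV_itv (i : 'I_r) : 0 < (beta i)^-1 <= 1.
Proof. by rewrite invr_gt0 beta_gt0 invf_le1 ?beta_gt0 ?beta_ge1. Qed.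

Lemma DE (x y : X) :
  D x y = \big[Num.max/0]_(i < r) (eucl (x i - y i) `^ (beta i)^-1).
Proof. by rewrite distE; apply: eq_bigr => i _; rewrite invf_div. Qed.

Lemma D_ge0 (x y : X) : 0 <= D x y.
Proof. by rewrite DE; apply: bigmax_ge_id. Qed.

(** With [D_leP], trades the maximum in [D] for one inequality per block. *)
Lemma D_block (x y : X) (i : 'I_r) : eucl (x i - y i) <= D x y `^ beta i.
Proof.
rewrite -[leLHS](powRVK (beta_gt0 i)) ?eucl_ge0 //.
apply: le_powR2l; [exact: ltW (beta_gt0 i) | exact: powR_ge0 | rewrite DE].
exact: (le_bigmax _ (fun i : 'I_r => eucl (x i - y i) `^ (beta i)^-1)).
Qed.

Lemma D_leP (x y : X) (s : R) : 0 <= s ->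
  (forall i : 'I_r, eucl (x i - y i) <= s `^ beta i) -> D x y <= s.
Proof.
move=> s0 h; rewrite DE; apply: bigmax_le => // i _.
rewrite -[leRHS](powRKV (beta_gt0 i)) //.
by apply: le_powR2l; rewrite ?eucl_ge0 // invr_ge0 ltW // beta_gt0.
Qed.

Lemma Dxx (x : X) : D x x = 0.
Proof.
apply/eqP; rewrite eq_le D_ge0 andbT; apply: D_leP => // i.
by rewrite subrr eucl0 powR_ge0.
Qed.

Lemma D_sym (x y : X) : D x y = D y x.
Proof. by rewrite !DE; apply: eq_bigr => i _; rewrite -euclN opprB. Qed.

Lemma D_eq0 (x y : X) : D x y = 0 -> x = y.
Proof.
move=> xy0; apply: functional_extensionality_dep => i.
apply/eqP; rewrite -subr_eq0; apply/eqP/eucl_eq0/eqP.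
rewrite eq_le eucl_ge0 andbT; apply: le_trans (D_block x y i) _.
by rewrite xy0 powR0 ?gt_eqF ?beta_gt0.
Qed.

Lemma D_gt0 (x y : X) : x <> y -> 0 < D x y.
Proof. by move=> xy; rewrite lt_def D_ge0 andbT; apply/eqP => /D_eq0. Qed.

Lemma D_triangle (y x z : X) : D x z <= D x y + D y z.
Proof.
rewrite [D x z]DE; apply: bigmax_le => [|i _]; first by rewrite addr_ge0 ?D_ge0.
have /andP[bV0 bV1] := betaV_itv i.
have b0 := beta_gt0 i.
have -> : x i - z i = (x i - y i) + (y i - z i) by rewrite addrA subrK.
apply: le_trans (le_powR2l (ltW bV0) (eucl_ge0 _) (euclD _ _)) _.
apply: le_trans (powR_subadditive (eucl_ge0 _) (eucl_ge0 _) (betaV_itv i)) _.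
rewrite -(powRKV b0 (D_ge0 x y)) -(powRKV b0 (D_ge0 y z)).
by apply: lerD; apply: le_powR2l (ltW bV0) (eucl_ge0 _) (D_block _ _ _).
Qed.

(* The leaves are the fibres [R^{n_1} * {pt}]: block [0] here is the paper's [x_1]. *)
Definition leaf (x y : X) : Prop := forall i : 'I_r, (0 < i)%N -> x i = y i.

Lemma leaf_refl x : leaf x x. Proof. by []. Qed.

Lemma leaf_sym x y : leaf x y -> leaf y x.
Proof. by move=> xy i i_gt0; rewrite xy. Qed.

Lemma leaf_trans y x z : leaf x y -> leaf y z -> leaf x z.
Proof. by move=> xy yz i i_gt0; rewrite xy // yz. Qed.

Lemma D_leaf x y : leaf x y -> D x y = eucl (x i0 - y i0).
Proof.
move=> xy; have := D_block x y i0; rewrite beta0 powRr1 ?D_ge0 // => le1.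
apply/eqP; rewrite eq_le le1 andbT; apply: D_leP => [|i]; first exact: eucl_ge0.
have [i_gt0|] := ltnP 0 i; first by rewrite xy // subrr eucl0 powR_ge0.
rewrite leqn0 => /eqP iE; have -> : i = i0 by apply: val_inj.
by rewrite beta0 powRr1 ?eucl_ge0.
Qed.

(* The foot, on the leaf of [y], of the perpendicular dropped from [x]. *)
Definition mix (x y : X) : X := fun i => if i == i0 then x i else y i.

Lemma leaf_mix x y : leaf (mix x y) y.
Proof. by move=> i i_gt0; rewrite /mix -val_eqE /= gtn_eqF. Qed.

(** Only blocks of positive index change from [x] to [mix x y], and these are constant on leaves; so
    [mix] realises the distance between two leaves. *)
Lemma D_mix_le x x' y y' : leaf x x' -> leaf y y' -> D x (mix x y) <= D x' y'.
Proof.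
move=> xx' yy'; apply: D_leP => [|i]; first exact: D_ge0.
rewrite /mix; case: eqP => [->|/eqP]; first by rewrite subrr eucl0 powR_ge0.
rewrite -val_eqE -lt0n => i_gt0.
by rewrite xx' // yy' // D_block.
Qed.

Definition push (p : X) (i : 'I_r) (c : R) : X :=
  fun j => if j == i then p j + c *: unit_row (ns j) else p j.

Lemma D_push p i c : 0 <= c -> D p (push p i (c `^ beta i)) = c.
Proof.
move=> c0; have e j : eucl (p j - push p i (c `^ beta i) j) =
    if j == i then c `^ beta i else 0.
  rewrite /push; case: eqP => [->|_]; last by rewrite subrr eucl0.
  rewrite opprD addNKr euclN euclZ eucl_unit_row ?ns_ge1 // mulr1.
  by rewrite ger0_norm ?powR_ge0.
apply/eqP; rewrite eq_le; apply/andP; split.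
  by apply: D_leP => // j; rewrite e; case: eqP => [->|_] //; rewrite powR_ge0.
rewrite DE; apply: le_trans (le_bigmax _ _ i).
by rewrite e eqxx powRKV ?beta_gt0.
Qed.

Lemma D_push0 p c : 0 <= c -> D p (push p i0 c) = c.
Proof. by move=> c0; rewrite -{1}(powRr1 c0) -beta0 (D_push p i0). Qed.

Lemma leaf_push0 p c : leaf p (push p i0 c).
Proof. by move=> i i_gt0; rewrite /push -val_eqE /= gtn_eqF. Qed.

Definition segment (p q : X) (t : R) : X := fun i => p i + t *: (q i - p i).

Lemma leaf_segment p q t : leaf p q -> leaf p (segment p q t).
Proof. by move=> pq i i_gt0; rewrite /segment pq // subrr scaler0 addr0. Qed.

Lemma segment0 p q : segment p q 0 = p.
Proof. by apply: functional_extensionality_dep => i; rewrite /segment scale0r addr0. Qed.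

Lemma segment1 p q : segment p q 1 = q.
Proof. by apply: functional_extensionality_dep => i; rewrite /segment scale1r subrKC. Qed.

Lemma D_segment p q s t : leaf p q ->
  D (segment p q s) (segment p q t) = `|s - t| * D p q.
Proof.
move=> pq; rewrite D_leaf; last first.
  exact: leaf_trans (leaf_sym (leaf_segment s pq)) (leaf_segment t pq).
rewrite (D_leaf pq) /segment opprD addrACA subrr add0r -scalerBl euclZ.
by rewrite -euclN opprB.
Qed.

(** * Quasisymmetric bijections that preserve leaves *)

(** Quasisymmetry at the single ratio one. Assumed for [F] and its inverse, with preservation of
    leaves, it carries the whole quantitative argument. *)
Definition weak_qs (H : R) (F : X -> X) : Prop :=
  forall x y z, D x y <= D x z -> D (F x) (F y) <= H * D (F x) (F z).

Definition leaf_map (F : X -> X) : Prop :=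
  forall x y, leaf x y -> leaf (F x) (F y).

Section LeafBijection.
Context {H : R} {F G : X -> X}.
Hypotheses (H_ge1 : 1 <= H) (FK : cancel F G) (GK : cancel G F).
Hypotheses (F_leaf : leaf_map F) (G_leaf : leaf_map G) (F_qs : weak_qs H F).

(* Parallel leaves are equidistant, so the perpendicular from [F x] to the image leaf
   has a preimage at least as far from [x] as [mix x y] is. *)
Lemma D_image_mix_le x x' y y' : leaf x x' -> leaf y y' ->
  D (F x) (F (mix x y)) <= H * D (F x') (F y').
Proof.
move=> xx' yy'; pose p := G (mix (F x) (F y)).
have yp : leaf y p.
  by apply: leaf_sym; rewrite /p -{2}(FK y); apply: G_leaf; apply: leaf_mix.
apply: le_trans (F_qs (D_mix_le (leaf_refl x) yp)) _.
apply: ler_wpM2l; first exact: le_trans ler01 H_ge1.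
by rewrite /p GK; apply: D_mix_le; apply: F_leaf.
Qed.

(* Both displacements are compared with the height of a parallel leaf
   at distance [D z z']. *)
Lemma leaf_compare x x' z z' : leaf x x' -> leaf x z -> D x x' <= D z z' ->
  D (F x) (F x') <= H ^+ 3 * D (F z) (F z').
Proof.
move=> xx' xz le_xz; set t := D z z' in le_xz.
have t0 : 0 <= t by exact: D_ge0.
(* A lift of height [t] in the second block, which exists because [r >= 2]. *)
pose up p := push p i1 (t `^ beta 1).
have mix_up p : mix p (up p) = up p.
  by apply: functional_extensionality_dep => i; rewrite /mix /up /push;
     case: eqP => // ->.
have up_leaf : leaf (up x) (up z) by move=> i i_gt0; rewrite /up /push xz.
have Dup p : D p (up p) = t by exact: (D_push p i1).
have H0 : 0 <= H := le_trans ler01 H_ge1.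
have s1 : D (F x) (F x') <= H * D (F x) (F (up x)).
  by apply: F_qs; rewrite Dup; exact: le_xz.
have s2 : D (F x) (F (up x)) <= H * D (F z) (F (up z)).
  by have := D_image_mix_le xz up_leaf; rewrite mix_up.
have s3 : D (F z) (F (up z)) <= H * D (F z) (F z').
  by apply: F_qs; rewrite Dup; exact: lexx.
apply: le_trans s1 _; rewrite !exprS expr0 mulr1 -!mulrA ler_wpM2l //.
by apply: le_trans s2 _; rewrite ler_wpM2l.
Qed.

(** Cut the segment from [p] to [q] into [N] equal steps, none longer than [D z z'], and apply
    [leaf_compare] to each. *)
Lemma leaf_chain (N : nat) p q z z' : leaf p q -> leaf p z ->
  D p q <= N%:R * D z z' ->
  D (F p) (F q) <= N%:R * (H ^+ 3 * D (F z) (F z')).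
Proof.
move=> pq pz; case: N => [|N] le_pq.
  have -> : p = q.
    by apply: D_eq0; apply/eqP; rewrite eq_le D_ge0 andbT -(mul0r (D z z')).
  by rewrite Dxx mul0r.
pose g k := segment p q (k%:R / N.+1%:R).
suff step k : D (F p) (F (g k)) <= k%:R * (H ^+ 3 * D (F z) (F z')).
  by have := step N.+1; rewrite /g divff ?segment1.
elim: k => [|k IH]; first by rewrite /g mul0r segment0 Dxx mul0r.
apply: le_trans (D_triangle (F (g k)) _ _) _.
rewrite -[k.+1%:R]natr1 mulrDl mul1r; apply: lerD; first exact: IH.
have pk := leaf_segment (k%:R / N.+1%:R) pq.
apply: leaf_compare.
- exact: leaf_trans (leaf_sym pk) (leaf_segment _ pq).
- exact: leaf_trans (leaf_sym pk) pz.
- rewrite D_segment // -mulrBl -natr1 opprD addNKr normrM normrN1 mul1r.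
  by rewrite ger0_norm ?invr_ge0 // mulrC ler_pdivrMr // mulrC.
Qed.

(** The summand [D z z'] on the right pays for rounding [N] up; it becomes negligible when [p] and
    [q] are far apart. *)
Lemma leaf_chain_linear p q z z' : leaf p q -> leaf p z -> 0 < D z z' ->
  D (F p) (F q) * D z z' <= H ^+ 3 * D (F z) (F z') * (D p q + D z z').
Proof.
move=> pq pz zz'; have [N N1 N2] := ceil_quotient (D_ge0 p q) zz'.
have h := leaf_chain pq pz N1.
have w : 0 <= H ^+ 3 * D (F z) (F z').
  by apply: mulr_ge0; [rewrite exprn_ge0 // (le_trans ler01 H_ge1) | exact: D_ge0].
have := ler_wpM2l w N2; have := ler_wpM2r (ltW zz') h; lra.
Qed.

End LeafBijection.

Section Ratio.
Context {H H' : R} {F G : X -> X}.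
Hypotheses (H_ge1 : 1 <= H) (H'_ge1 : 1 <= H').
Hypotheses (FK : cancel F G) (GK : cancel G F).
Hypotheses (F_leaf : leaf_map F) (G_leaf : leaf_map G).
Hypotheses (F_qs : weak_qs H F) (G_qs : weak_qs H' G).

(* Displacements at the two given scales are compared through a displacement of
   length [T] along each leaf: as [T] grows, the images of the two long displacements
   differ by a bounded amount and the rounding errors disappear. *)
Lemma leaf_ratio p q p' q' : leaf p q -> leaf p' q' -> p <> q -> p' <> q' ->
  D (F p) (F q) * D p' q' <= H ^+ 3 * H' ^+ 3 * D p q * D (F p') (F q').
Proof.
move=> pq pq' npq npq'.
have F_inj := can_inj FK.
have t1 := D_gt0 npq; have t2 := D_gt0 npq'.
have s1 : 0 < D (F p) (F q) by apply: D_gt0 => /F_inj.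
have s2 : 0 < D (F p') (F q') by apply: D_gt0 => /F_inj.
(* [o'] is the foot of [p] on the leaf of [p']. Parallel displacements of length [T] from [p] and
   [o'] end at points whose images are at most [H * c] apart, whatever [T] is. *)
pose o' := mix p p'; pose c := D (F p) (F o').
have H0 : 0 <= H := le_trans ler01 H_ge1.
have H0' : 0 <= H' := le_trans ler01 H'_ge1.
have c0 : 0 <= (1 + H) * c by rewrite mulr_ge0 ?addr_ge0 ?D_ge0.
apply: (linear_comparison (ltW s1) (ltW t1) (ltW s2) (ltW t2)
  (exprn_ge0 3 H0) (exprn_ge0 3 H0') c0) => T T0.
pose z := push p i0 T; pose z' := push o' i0 T.
have zE : z' = mix z p'.
  by apply: functional_extensionality_dep => i; rewrite /z' /z /o' /push /mix; case: eqP.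
have pz : leaf p z := leaf_push0 p T.
have oz' : leaf o' z' := leaf_push0 o' T.
have op' : leaf o' p' := leaf_mix p p'.
exists (D (F p) (F z)), (D (F o') (F z')); split.
(* Chaining for the inverse bounds the image of the long displacement from below. *)
- have := leaf_chain_linear H'_ge1 GK FK G_leaf F_leaf G_qs (F_leaf pz)
      (leaf_refl (F p)) s1.
  by rewrite !FK (D_push0 p T0); exact: id.
- have := leaf_chain_linear H_ge1 FK GK F_leaf G_leaf F_qs oz' op' t2.
  by rewrite (D_push0 o' T0); exact: id.
- have h3 : D (F z) (F z') <= H * c.
    rewrite zE; apply: (D_image_mix_le H_ge1 FK GK F_leaf G_leaf F_qs).
      exact: leaf_sym.
    exact: leaf_sym.
  have h4 := D_triangle (F o') (F p) (F z).
  have h5 := D_triangle (F z') (F o') (F z).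
  rewrite (D_sym (F z')) in h5.
  rewrite mulrDl mul1r; move: h3 h4 h5; rewrite -/c.
  move: (D (F p) (F z)) (D (F o') (F z')) (D (F z) (F z')) (D (F o') (F z)) (H * c).
  by move=> *; lra.
Qed.

(** [C] is the stretch of one reference displacement of length one. [leaf_ratio] compares it with a
    leaf displacement from [x] of length [D x y]; one more factor [H] passes from there to [y]. *)
Lemma leaf_map_quasisim K : H ^+ 4 * H' ^+ 3 <= K ->
  exists2 C : R, 0 < C & quasisim (@Dmet R r ns alpha) K C F.
Proof.
rewrite -distE.
move=> leK.
have H0 : 0 <= H := le_trans ler01 H_ge1.
have H0' : 0 <= H' := le_trans ler01 H'_ge1.
pose p0 : X := fun _ => 0; pose q0 := push p0 i0 1.
have D0 : D p0 q0 = 1 by rewrite D_push0.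
have npq0 : p0 <> q0.
  by move=> e; move: D0; rewrite -e Dxx => /eqP; rewrite eq_sym oner_eq0.
have lpq0 : leaf p0 q0 := leaf_push0 p0 1.
exists (D (F p0) (F q0)); first by apply: D_gt0 => /(can_inj FK).
set C := D (F p0) (F q0).
have C0 : 0 < C by apply: D_gt0 => /(can_inj FK).
have K0 : 0 < K.
  by apply: lt_le_trans leK; rewrite mulr_gt0 // exprn_gt0 // (lt_le_trans ltr01).
have both x y : C * D x y <= K * D (F x) (F y) /\ D (F x) (F y) <= K * (C * D x y).
  have [->|nxy] := pselect (x = y); first by rewrite !Dxx !mulr0.
  pose y' := push x i0 (D x y).
  have Dxy' : D x y' = D x y by rewrite D_push0 ?D_ge0.
  have lxy' : leaf x y' := leaf_push0 _ _.
  have nxy' : x <> y' by move=> e; have := D_gt0 nxy; rewrite -Dxy' -e Dxx ltxx.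
  have b1 := leaf_ratio lxy' lpq0 nxy' npq0.
  have b2 := leaf_ratio lpq0 lxy' npq0 nxy'.
  rewrite D0 mulr1 Dxy' -/C in b1; rewrite D0 mulr1 Dxy' -/C in b2.
  have b3 : D (F x) (F y) <= H * D (F x) (F y') by apply: F_qs; rewrite Dxy'.
  have b4 : D (F x) (F y') <= H * D (F x) (F y) by apply: F_qs; rewrite Dxy'.
  have E0 : 0 <= H ^+ 3 * H' ^+ 3 by rewrite mulr_ge0 ?exprn_ge0.
  have leK' : H * (H ^+ 3 * H' ^+ 3) <= K by rewrite mulrA -exprS.
  have CD0 : 0 <= C * D x y by rewrite mulr_ge0 ?D_ge0 // ltW.
  split.
    apply: le_trans b2 (le_trans (ler_wpM2l E0 b4) _).
    by rewrite mulrA [_ * H]mulrC ler_wpM2r ?D_ge0.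
  apply: le_trans b3 (le_trans (ler_wpM2l H0 b1) _).
  by rewrite -mulrA [D x y * C]mulrC mulrA ler_wpM2r.
split=> [x y|]; last split=> [x y|]; last by exists G.
  have [h _] := both x y.
  by rewrite mulrAC ler_pdivrMr // [leRHS]mulrC.
by have [_ h] := both x y; rewrite [C * K]mulrC -mulrA.
Qed.

End Ratio.

(** * Coordinates, boxes and the energy of a family of steps *)

Local Notation Ix := {i : 'I_r & 'I_(ns i)}.

Definition coord (x : X) (k : Ix) : R := x (tag k) ord0 (tagged k).

Definition of_coord (u : Ix -> R) : X :=
  fun i => \row_j u (Tagged (fun i : 'I_r => 'I_(ns i)) j).

Lemma coordK u k : coord (of_coord u) k = u k.
Proof. by rewrite /coord /of_coord mxE; case: k. Qed.

Lemma coord_inj x y : coord x =1 coord y -> x = y.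
Proof.
move=> xy; apply: functional_extensionality_dep => i; apply/rowP => j.
exact: (xy (Tagged (fun i : 'I_r => 'I_(ns i)) j)).
Qed.

Lemma leaf_coord x y : (forall k : Ix, (0 < tag k)%N -> coord x k = coord y k) ->
  leaf x y.
Proof.
move=> xy i i_gt0; apply/rowP => j.
exact: (xy (Tagged (fun i : 'I_r => 'I_(ns i)) j)).
Qed.

Lemma norm_coord_le x y k : `|coord x k - coord y k| <= D x y `^ beta (tag k).
Proof.
apply: le_trans (D_block x y (tag k)).
by have := norm_coord_le_eucl (x (tag k) - y (tag k)) (tagged k); rewrite !mxE.
Qed.

Definition box_const : R := 1 + \sum_(i < r) (ns i)%:R.
Local Notation M := box_const.

Lemma box_const_ge1 : 1 <= M.
Proof. by rewrite lerDl sumr_ge0. Qed.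

(** Passing from coordinates to the Euclidean norm costs a factor [ns i <= M], and [M] is at most
    its power [beta i] since both are at least one. *)
Lemma D_le_box x y s : 0 <= s ->
  (forall k, `|coord x k - coord y k| <= s `^ beta (tag k)) -> D x y <= M * s.
Proof.
move=> s0 h; have M1 := box_const_ge1; have M0 : 0 <= M := le_trans ler01 M1.
apply: D_leP => [|i]; first exact: mulr_ge0.
apply: le_trans (eucl_le_sum _) _.
have : \sum_j `|(x i - y i) ord0 j| <= \sum_(j < ns i) (s `^ beta i).
  apply: ler_sum => j _; have := h (Tagged (fun i : 'I_r => 'I_(ns i)) j).
  by rewrite /coord /= !mxE.
rewrite sumr_const card_ord -mulr_natl => /le_trans; apply.
rewrite powRM // ler_wpM2r ?powR_ge0 //.
apply: le_trans (le1r_powR M1 (beta_ge1 i)).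
by rewrite /box_const (bigD1 i) //= addrCA lerDl addr_ge0 // sumr_ge0.
Qed.

(* The homogeneous dimension of [(X, D)]. *)
Definition hdim : R := \sum_(k : Ix) beta (tag k).

(** Some constant for each ratio, without control on it: enough for the qualitative fact that leaves
    go to leaves. *)
Definition rough_qs (F : X -> X) : Prop := forall l : R, 0 < l ->
  exists2 H : R, 0 < H &
    forall x y z, D x y <= l * D x z -> D (F x) (F y) <= H * D (F x) (F z).

(* By quasisymmetry the images contain pairwise disjoint boxes of comparable size. *)
Lemma energy_bound F G : cancel F G -> cancel G F -> rough_qs F ->
  exists2 c : R, 0 < c &
  forall (J : finType) (g g' : J -> X) (e A : R) (o : X), 0 < e -> 0 < A ->
    (forall i j, (forall k, `|coord (g i) k - coord (g j) k| < e `^ beta (tag k)) ->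
      i = j) ->
    (forall j, D (g j) (g' j) <= M * e) -> (forall j, g j <> g' j) ->
    (forall j, D o (F (g j)) <= A) -> (forall j, D o (F (g' j)) <= A) ->
    \sum_j D (F (g j)) (F (g' j)) `^ hdim <= c * A `^ hdim.
Proof.
move=> FK GK F_qs.
have M1 := box_const_ge1; have M0 : 0 < M := lt_le_trans ltr01 M1.
have [H H0 {}F_qs] := F_qs (3 * M) (mulr_gt0 (ltr0n _ 3) M0).
pose c := (2 * M * H)^-1.
have c0 : 0 < c by rewrite invr_gt0 !mulr_gt0.
(* Box points lie within [A + M * c * (2 * A) = B * A] of [o]. *)
pose B := 1 + 2 * (M * c).
have B0 : 0 < B by rewrite addr_gt0 // !mulr_gt0.
exists (2 ^+ #|{: Ix}| * B `^ hdim / c `^ hdim).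
  by rewrite divr_gt0 ?mulr_gt0 ?exprn_gt0 ?powR_gt0.
move=> J g g' e A o e0 A0 sep step neq oA oA'.
pose d j := D (F (g j)) (F (g' j)).
have d0 j : 0 < d j by apply: D_gt0 => /(can_inj FK) /neq.
have dA j : d j <= 2 * A.
  have := D_triangle o (F (g j)) (F (g' j)); rewrite [D (F (g j)) o]D_sym.
  have := oA j; have := oA' j; rewrite /d; lra.
have cd0 j : 0 < c * d j by exact: mulr_gt0.
have near j z : (forall k, `|z k - coord (F (g j)) k| <= (c * d j) `^ beta (tag k)) ->
    D (F (g j)) (of_coord z) <= M * (c * d j).
  move=> h; apply: D_le_box => [|k]; first exact: ltW.
  by rewrite coordK distrC.
(* A preimage at distance at least [e / 3] from [g j] would dominate the step to [g' j] up to the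
   ratio [3 * M], and the choice of [c] would give [d j <= d j / 2]. *)
have back j z : (forall k, `|z k - coord (F (g j)) k| <= (c * d j) `^ beta (tag k)) ->
    D (g j) (G (of_coord z)) < e / 3.
  move=> /near h; rewrite ltNge; apply/negP => far.
  have : d j <= H * D (F (g j)) (F (G (of_coord z))).
    apply: F_qs; apply: le_trans (step j) _.
    by rewrite [3 * M]mulrC -mulrA ler_pM2l //; lra.
  rewrite GK => /le_trans /(_ (ler_wpM2l (ltW H0) h)).
  have -> : H * (M * (c * d j)) = d j / 2.
    by rewrite /c; field; rewrite !gt_eqF.
  by have := d0 j; lra.
have pack := @box_packing R {: Ix} J (fun j => coord (F (g j)))
  (fun j k => (c * d j) `^ beta (tag k)) (coord o)
  (fun k => (B * A) `^ beta (tag k)).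
have BA0 : 0 < B * A by rewrite mulr_gt0.
have {}pack : \sum_j (c * d j) `^ hdim <= 2 ^+ #|{: Ix}| * (B * A) `^ hdim.
  have powE x : 0 < x -> x `^ hdim = \prod_(k : Ix) x `^ beta (tag k).
    exact: powR_sum.
  rewrite (powE _ BA0) (eq_bigr _ (fun j _ => powE _ (cd0 j))).
  apply: pack.
  - by move=> j k; apply: powR_gt0.
  - by move=> k; apply: powR_gt0.
  (* If two boxes met, [g i] and [g j] would differ in coordinate [k] by at most two thirds of
     [e^beta], as [beta >= 1]. *)
  - move=> i j z zi zj; apply: sep => k.
    have b1 := beta_ge1 (tag k); have b0 : 0 <= beta (tag k) := ltW (beta_gt0 _).
    have e3 : (e / 3) `^ beta (tag k) <= e `^ beta (tag k) / 3.
      rewrite mulrC [leRHS]mulrC ge1r_powRZ // ?(ltW e0) //.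
      by apply/andP; split; lra.
    have ti := le_trans (norm_coord_le (g i) (G (of_coord z)) k)
      (le_powR2l b0 (D_ge0 _ _) (ltW (back i z zi))).
    have tj := le_trans (norm_coord_le (g j) (G (of_coord z)) k)
      (le_powR2l b0 (D_ge0 _ _) (ltW (back j z zj))).
    have ep := powR_gt0 (beta (tag k)) e0.
    rewrite -(subrK (coord (G (of_coord z)) k) (coord (g i) k)) -addrA.
    apply: le_lt_trans (ler_normD _ _) _; rewrite [X in _ + X]distrC.
    lra.
  - move=> j z /near h k; rewrite distrC -(coordK z).
    apply: le_trans (norm_coord_le _ _ _) _.
    apply: le_powR2l; rewrite ?D_ge0 ?(ltW (beta_gt0 _)) //.
    apply: le_trans (D_triangle (F (g j)) _ _) _.
    have h' : M * (c * d j) <= M * (c * (2 * A)).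
      by rewrite ler_pM2l // ler_pM2l.
    have := oA j; rewrite /B mulrDl mul1r; lra.
rewrite mulrAC ler_pdivlMr ?powR_gt0 // -mulrA -powRM ?(ltW B0) ?(ltW A0) //.
apply: le_trans pack; rewrite mulr_suml; apply: ler_sum => j _.
by rewrite powRM ?(ltW c0) ?D_ge0 // mulrC.
Qed.

Lemma coord_continuous F p k (e : R) : dcontinuous D F -> 0 < e ->
  exists2 w : R, 0 < w & forall x,
    (forall i, `|coord p i - coord x i| <= w `^ beta (tag i)) ->
    `|coord (F p) k - coord (F x) k| <= e.
Proof.
move=> F_cont e0; have M0 : 0 < M := lt_le_trans ltr01 box_const_ge1.
have [s s0 hs] := F_cont p (e `^ (beta (tag k))^-1) (powR_gt0 _ e0).
exists (s / (2 * M)) => [|x px]; first by rewrite divr_gt0 // mulr_gt0.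
have px' : D p x < s.
  apply: le_lt_trans (D_le_box _ px) _; first by rewrite divr_ge0 ?mulr_ge0 // ltW.
  have -> : M * (s / (2 * M)) = s / 2 by field; rewrite gt_eqF.
  lra.
apply: le_trans (norm_coord_le _ _ _) _.
rewrite -[leRHS](powRVK (beta_gt0 (tag k)) (ltW e0)).
by apply: le_powR2l; rewrite ?D_ge0 ?(ltW (beta_gt0 _)) // ltW // hs.
Qed.

(** Each increment of coordinate [k] is at most a [D]-step raised to [beta (tag k)], a power above
    one outside the first block. *)
Lemma dist_telescope (F : X -> X) (k : Ix) (N : nat) (g : nat -> X) :
  `|coord (F (g 0%N)) k - coord (F (g N)) k| <=
    \sum_(a < N) D (F (g a)) (F (g a.+1)) `^ beta (tag k).
Proof.
elim: N => [|N IH]; first by rewrite subrr normr0 big_ord0.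
rewrite big_ord_recr /= -(subrK (coord (F (g N)) k) (coord (F (g 0%N)) k)) -addrA.
apply: le_trans (ler_normD _ _) _; apply: lerD; first exact: IH.
exact: norm_coord_le.
Qed.

(** * Moving one coordinate of the first block: grid and averaging *)

Section CoordinateMove.
Context {p q : X} {k0 : Ix}.
Hypothesis k0_first : tag k0 = i0.
Hypothesis eq_pq : forall k, k != k0 -> coord p k = coord q k.
Hypothesis neq_pq : p <> q.

Let lam := `|coord q k0 - coord p k0|.

Lemma lam_gt0 : 0 < lam.
Proof.
rewrite normr_gt0 subr_eq0; apply/eqP => e; apply: neq_pq; apply: coord_inj => k.
by have [->|/eq_pq] := eqVneq k k0.
Qed.

Lemma beta_k0 : beta (tag k0) = 1.
Proof. by rewrite k0_first beta0. Qed.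

(** [u] selects a line parallel to the segment from [p] to [q], and [a] the step on it; the offset
    unit in each coordinate corresponds to the [D]-length [lam / N]. *)
Definition grid (N : nat) (u : Ix -> nat) (a : nat) : X :=
  of_coord (fun k => coord p k + (u k)%:R * (lam / N%:R) `^ beta (tag k) +
    a%:R / N%:R * (coord q k - coord p k)).

(* One cell in the direction of motion, which the index [a] of [grid] takes care of. *)
Definition cells (w : R) (N : nat) (k : Ix) : nat :=
  if k == k0 then 1%N else Num.truncn ((w * N%:R / lam) `^ beta (tag k)).

Section Cells.
Context {w : R} {N : nat} {u : Ix -> nat}.
Hypotheses (w_gt0 : 0 < w) (N_gt0 : (0 < N)%N).
Hypothesis u_lt : forall k, (u k < cells w N k)%N.

Lemma cell_k0 : u k0 = 0%N.
Proof. by have := u_lt k0; rewrite /cells eqxx; case: (u k0). Qed.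

(** Off [k0], at most [(w * N / lam)^beta] cells of side [(lam / N)^beta] fit in [w^beta]; hence all
    lines start near [p] and end near [q]. *)
Lemma cell_offset k : 0 <= (u k)%:R * (lam / N%:R) `^ beta (tag k) <= w `^ beta (tag k).
Proof.
have lam0 := lam_gt0; have N0 : 0 < N%:R :> R by rewrite ltr0n.
rewrite mulr_ge0 ?powR_ge0 //=.
have [->|kk0] := eqVneq k k0; first by rewrite cell_k0 mul0r powR_ge0.
have ek : w `^ beta (tag k) =
    (w * N%:R / lam) `^ beta (tag k) * (lam / N%:R) `^ beta (tag k).
  rewrite -powRM ?divr_ge0 ?mulr_ge0 ?(ltW lam0) ?(ltW w_gt0) //.
  by congr (_ `^ _); field; rewrite !gt_eqF.
rewrite ek ler_wpM2r ?powR_ge0 //.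
have := u_lt k; rewrite /cells (negPf kk0) => /ltnW.
by rewrite truncn_ge_nat ?powR_ge0.
Qed.

Lemma grid_start k :
  `|coord p k - coord (grid N u 0) k| <= w `^ beta (tag k).
Proof.
have /andP[ off0 offw] := cell_offset k.
by rewrite coordK mul0r mul0r addr0 opprD addNKr normrN ger0_norm.
Qed.

Lemma grid_end k :
  `|coord q k - coord (grid N u N) k| <= w `^ beta (tag k).
Proof.
have /andP[ off0 offw] := cell_offset k.
rewrite coordK divff ?pnatr_eq0 -?lt0n // mul1r.
set o := _ * _ in off0 offw *.
have -> : coord q k - (coord p k + o + (coord q k - coord p k)) = - o by ring.
by rewrite normrN ger0_norm.
Qed.

Lemma grid_bounded a k : (a <= N)%N ->
  `|coord p k - coord (grid N u a) k| <= (w + lam) `^ beta (tag k).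
Proof.
move=> aN; have lam0 := lam_gt0; have N0 : 0 < N%:R :> R by rewrite ltr0n.
have b0 := ltW (beta_gt0 (tag k)).
rewrite coordK -addrA opprD addNKr normrN.
have [kk0|kk0] := eqVneq k k0.
  rewrite kk0 cell_k0 mul0r add0r normrM -/lam beta_k0.
  rewrite powRr1; last by rewrite addr_ge0 // ltW.
  rewrite ger0_norm ?divr_ge0 //.
  apply: le_trans (_ : lam <= _); last by rewrite lerDr ltW.
  by rewrite ger_pMl // ler_pdivrMr // mul1r ler_nat.
rewrite eq_pq // subrr mulr0 addr0.
have /andP[ off0 offw] := cell_offset k; rewrite ger0_norm //; apply: le_trans offw _.
by apply: le_powR2l => //; [exact: ltW | rewrite lerDl ltW].
Qed.

End Cells.

Lemma grid_step N u a : (0 < N)%N ->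
  D (grid N u a) (grid N u a.+1) <= M * (lam / N%:R).
Proof.
move=> N_gt0; have lam0 := lam_gt0; have N0 : 0 < N%:R :> R by rewrite ltr0n.
apply: D_le_box => [|k]; first by rewrite divr_ge0 // ltW.
rewrite !coordK; set o := coord p k + _.
have -> : o + a%:R / N%:R * (coord q k - coord p k) -
    (o + a.+1%:R / N%:R * (coord q k - coord p k)) =
    - ((coord q k - coord p k) / N%:R) by rewrite -natr1; ring.
rewrite normrN normrM.
have [->|kk0] := eqVneq k k0; last by rewrite eq_pq // subrr normr0 mul0r powR_ge0.
rewrite beta_k0 powRr1 ?divr_ge0 ?(ltW lam0) //.
by rewrite [`|_^-1|]ger0_norm ?invr_ge0.
Qed.

(** Off [k0] the coordinates encode the line, at [k0] the step, both as integer multiples of a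
    mesh. *)
Lemma grid_separated N u v a b : (0 < N)%N -> u k0 = v k0 ->
  (forall k, `|coord (grid N u a) k - coord (grid N v b) k| <
    (lam / N%:R) `^ beta (tag k)) -> u =1 v /\ a = b.
Proof.
move=> N_gt0 uv0 close.
have lam0 := lam_gt0; have N0 : 0 < N%:R :> R by rewrite ltr0n.
have e0 : 0 < lam / N%:R by rewrite divr_gt0.
split=> [k|].
  have [->|kk0] := eqVneq k k0; first exact: uv0.
  have := close k; rewrite !coordK eq_pq // subrr !mulr0 !addr0.
  by rewrite opprD addrACA subrr add0r => /nat_close; apply; apply: powR_gt0.
have := close k0; rewrite !coordK uv0 beta_k0 powRr1 ?(ltW e0) //.
rewrite opprD addrACA subrr add0r => h; apply: (nat_close e0).
rewrite -mulrBl normrM (gtr0_norm e0); apply: le_lt_trans h.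
rewrite -mulrBl normrM -/lam -mulrBl normrM.
by rewrite [`|N%:R^-1|]ger0_norm ?invr_ge0 // mulrAC mulrA.
Qed.

(** The integer part of a number [y >= 1] is at least [y / 2]; the single cell at [k0], where [beta]
    is one, lowers the exponent to [hdim - 1]. *)
Lemma prod_cells_ge w N : 0 < w -> lam <= w * N%:R ->
  (\prod_(k | k != k0) ((w / lam) `^ beta (tag k) / 2)) * N%:R `^ (hdim - 1)
    <= #|{dffun forall k : Ix, 'I_(cells w N k)}|%:R.
Proof.
move=> w0 lamN; have lam0 := lam_gt0.
have N0 : 0 < N%:R :> R.
  by rewrite lt_def ler0n andbT; apply/eqP => e; move: lamN; rewrite e mulr0 leNgt lam0.
rewrite card_dep_ffun foldrE big_map big_enum /= natr_prod.
rewrite [leRHS](bigD1 k0) //= card_ord {1}/cells eqxx mul1r.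
have -> : hdim - 1 = \sum_(k : Ix | k != k0) beta (tag k).
  by rewrite /hdim (bigD1 k0) //= beta_k0 addrAC subrr add0r.
rewrite powR_sum // -big_split /=; apply: ler_prod => k kk0.
rewrite card_ord /cells (negPf kk0).
rewrite mulr_ge0 ?divr_ge0 ?powR_ge0 //= mulrAC.
rewrite -powRM ?divr_ge0 ?(ltW w0) ?(ltW lam0) //.
rewrite [w / lam * _]mulrAC; set y := _ `^ _.
have y1 : 1 <= y.
  have -> : 1 = 1 `^ beta (tag k) :> R by rewrite powR1.
  apply: le_powR2l => //; first exact: ltW (beta_gt0 _).
  by rewrite ler_pdivlMr // mul1r.
have /andP[_] := truncn_itv (le_trans ler01 y1).
have : 1 <= (Num.truncn y)%:R :> R by rewrite ler1n truncn_gt0.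
rewrite -natr1; lra.
Qed.

(** Averaging over the lines, [key] bounds [N^(b-1)] independently of [N], which is absurd for
    [b > 1]. *)
Lemma coord_move F G (k : Ix) : cancel F G -> cancel G F -> dcontinuous D F ->
  rough_qs F -> (0 < tag k)%N -> coord (F p) k = coord (F q) k.
Proof.
move=> FK GK F_cont F_qs k_gt0; apply/eqP/negP => /negP neqF.
have lam0 := lam_gt0; have M0 : 0 < M := lt_le_trans ltr01 box_const_ge1.
set b := beta (tag k); have b1 : 1 < b := beta_gt1 k_gt0.
(* A quarter of the gap: losing [del] at both ends still leaves each line a variation of
   [2 * del]. *)
pose del := `|coord (F p) k - coord (F q) k| / 4.
have del0 : 0 < del by rewrite divr_gt0 // normr_gt0 subr_eq0.
have [w1 w1_gt0 nearp] := coord_continuous p k F_cont del0.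
have [w2 w2_gt0 nearq] := coord_continuous q k F_cont del0.
pose w := Num.min w1 w2.
have w0 : 0 < w by rewrite lt_min w1_gt0.
have w_le (i : Ix) : w `^ beta (tag i) <= w1 `^ beta (tag i) /\
              w `^ beta (tag i) <= w2 `^ beta (tag i).
  by split; (apply: le_powR2l; [exact: ltW (beta_gt0 _) | exact: ltW |
    by rewrite /w ge_min lexx ?orbT]).
have Dpq := D_gt0 neq_pq.
(* Grid points lie within [M * (w + lam)] of [p], so their images stay within [A] of [F p],
   uniformly in [N]. *)
have [H H0 Hqs] := F_qs (M * (w + lam) / D p q)
  (divr_gt0 (mulr_gt0 M0 (addr_gt0 w0 lam0)) Dpq).
pose A := H * D (F p) (F q).
have A0 : 0 < A by apply: mulr_gt0 => //; apply: D_gt0 => /(can_inj FK) /neq_pq.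
have [c c0 energy] := energy_bound FK GK F_qs.
pose C := c * A `^ hdim.
have C0 : 0 < C by rewrite mulr_gt0 ?powR_gt0.
pose c1 := \prod_(k | k != k0) ((w / lam) `^ beta (tag k) / 2).
have c10 : 0 < c1 by apply: prodr_gt0 => i _; rewrite divr_gt0 ?powR_gt0 ?divr_gt0.
have b_hdim : b <= hdim.
  rewrite /hdim (bigD1 k) //= lerDl; apply: sumr_ge0 => i _; exact: ltW (beta_gt0 _).
have key N : (0 < N)%N -> lam <= w * N%:R ->
    N%:R `^ b * (2 * del) <= N%:R * (1 + C / c1).
  move=> N_gt0 lamN; have N0 : 0 < N%:R :> R by rewrite ltr0n.
  pose J := {dffun forall k : Ix, 'I_(cells w N k)}.
  pose U (l : J) (i : Ix) : nat := l i.
  have U_lt l i : (U l i < cells w N i)%N by exact: ltn_ord.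
  pose g l a := grid N (U l) a.
  have gA l a : (a <= N)%N -> D (F p) (F (g l a)) <= A.
    move=> aN; apply: Hqs; rewrite divfK ?gt_eqF //.
    apply: D_le_box; first by rewrite addr_ge0 // ltW.
    by move=> i; apply: grid_bounded => //.
  pose d (l : J) (a : nat) := D (F (g l a)) (F (g l a.+1)).
  have sumQ : \sum_(ja : J * 'I_N) d ja.1 ja.2 `^ hdim <= C.
    apply: (energy _ (fun ja : J * 'I_N => g ja.1 ja.2) (fun ja => g ja.1 ja.2.+1)
      (lam / N%:R) A (F p)) => //.
    - by rewrite divr_gt0.
    - move=> [l a] [l' a'] /= close.
      have uv0 : U l k0 = U l' k0 by rewrite !(cell_k0 (U_lt _)).
      have [ll' aa'] := grid_separated N_gt0 uv0 close.
      congr (_, _); last exact: val_inj.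
      by apply/ffunP => i; apply: val_inj; exact: ll'.
    - by move=> [l a] /=; apply: grid_step.
    - move=> [l a] /= e.
      have uv0 : U l k0 = U l k0 by [].
      have [|_ /eqP] := @grid_separated N (U l) (U l) a a.+1 N_gt0 uv0.
        by move=> i; rewrite -/(g l a) e subrr normr0 powR_gt0 // divr_gt0.
      by rewrite -[X in X == _]addn0 -addn1 eqn_add2l.
    - by move=> [l a] /=; apply: gA; exact: ltnW (ltn_ord a).
    - by move=> [l a] /=; apply: gA; exact: ltn_ord.
  have line l : 2 * del <= \sum_(a < N) d l a `^ b.
    apply: le_trans (dist_telescope F k N (g l)).
    have hp : `|coord (F p) k - coord (F (g l 0%N)) k| <= del.
      by apply: nearp => i; apply: le_trans (grid_start w0 N_gt0 (U_lt l) i) (w_le i).1.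
    have hq : `|coord (F q) k - coord (F (g l N)) k| <= del.
      by apply: nearq => i; apply: le_trans (grid_end w0 N_gt0 (U_lt l) i) (w_le i).2.
    have : `|coord (F p) k - coord (F q) k| = 4 * del by rewrite /del; field.
    have := ler_distD (coord (F (g l 0%N)) k) (coord (F p) k) (coord (F q) k).
    have := ler_distD (coord (F (g l N)) k) (coord (F (g l 0%N)) k) (coord (F q) k).
    rewrite [`|coord (F (g l N)) k - coord (F q) k|]distrC; lra.
  pose L := #|{: J}|%:R : R.
  have Lge : c1 * N%:R `^ (hdim - 1) <= L by exact: prod_cells_ge.
  have L0 : 0 < L by apply: lt_le_trans Lge; rewrite mulr_gt0 ?powR_gt0.
  (* [powR_le_1D] at [N] times each step, summed over all [L] lines: the ones give [N * L], the
     powers [hdim] at most [N^hdim * C] by the energy bound. *)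
  have tot : L * (N%:R `^ b * (2 * del)) <= N%:R * L + N%:R `^ hdim * C.
    have sumJ (x : R) : L * x = \sum_(l : J) x.
      by rewrite /L mulr_natl sumr_const; congr (_ *+ _); apply: eq_card.
    rewrite (sumJ (_ * _)).
    apply: le_trans (_ : \sum_(l : J) \sum_(a < N)
      (1 + N%:R `^ hdim * d l a `^ hdim) <= _).
      apply: ler_sum => l _; apply: le_trans (ler_wpM2l (powR_ge0 _ _) (line l)) _.
      rewrite mulr_sumr; apply: ler_sum => a _.
      rewrite -!powRM ?D_ge0 //; apply: powR_le_1D => //.
        by rewrite mulr_ge0 ?D_ge0.
      exact: le_trans ler01 (ltW b1).
    under eq_bigr => l _ do rewrite big_split /= sumr_const card_ord.
    rewrite big_split /= [N%:R * L]mulrC sumJ lerD2l.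
    under eq_bigr => l _ do rewrite -mulr_sumr.
    rewrite -mulr_sumr ler_wpM2l ?powR_ge0 //.
    by rewrite pair_big.
  have hN : N%:R `^ hdim = N%:R * N%:R `^ (hdim - 1).
    by rewrite mulr_powRB1 // (lt_le_trans _ b_hdim) // (lt_trans ltr01 b1).
  have hN' : N%:R `^ (hdim - 1) * C <= L * (C / c1).
    rewrite [leLHS]mulrC [leRHS]mulrCA ler_wpM2l ?(ltW C0) //.
    by rewrite ler_pdivlMr // mulrC.
  rewrite -(ler_pM2l L0); apply: le_trans tot _.
  rewrite hN -mulrA; have := ler_wpM2l (ltW N0) hN'; lra.
pose t := 1 + C / c1.
have t0 : 0 < t by rewrite addr_gt0 // divr_gt0.
(* The first entry secures a cell in every direction, the second makes [N^(b-1) * del >= t], against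
   the bound [N^(b-1) * (2 * del) <= t] from [key]. *)
pose y := Num.max (lam / w) ((t / del) `^ (b - 1)^-1).
pose N := (Num.truncn y).+1.
have yN : y < N%:R by exact: truncnS_gt.
have N0 : 0 < N%:R :> R by rewrite ltr0n.
have y1 : lam <= w * N%:R.
  rewrite mulrC -ler_pdivrMr //; apply: le_trans (ltW yN).
  by rewrite le_max lexx.
have bm : 0 < b - 1 by rewrite subr_gt0.
have y2 : t / del <= N%:R `^ (b - 1).
  rewrite -[leLHS](powRVK bm); last by rewrite divr_ge0 // ltW.
  apply: le_powR2l; [exact: ltW | exact: powR_ge0 | apply: le_trans (ltW yN)].
  by rewrite le_max lexx orbT.
have := key N isT y1; rewrite -/t -(mulr_powRB1 (ltW N0) (lt_trans ltr01 b1)).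
rewrite -mulrA ler_pM2l //.
by rewrite ler_pdivrMr // in y2; lra.
Qed.

End CoordinateMove.

(** Switch coordinates from [x] to [y] one at a time. A switch that moves the point is in the first
    block, so [coord_move] applies to it. *)
Lemma rough_qs_leaf_map F G : cancel F G -> cancel G F -> dcontinuous D F ->
  rough_qs F -> leaf_map F.
Proof.
move=> FK GK F_cont F_qs x y xy.
pose h (s : seq Ix) := of_coord (fun k => if k \in s then coord y k else coord x k).
have xyc (k : Ix) : (0 < tag k)%N -> coord x k = coord y k.
  by move=> k_gt0; rewrite /coord xy.
suff hs s : leaf (F x) (F (h s)).
  have -> : y = h (enum {: Ix}) by apply: coord_inj => k; rewrite coordK mem_enum.
  exact: hs.
elim: s => [|k s IH].
  have -> : h [::] = x by apply: coord_inj => k; rewrite coordK.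
  exact: leaf_refl.
apply: leaf_trans IH _.
have [eh|neh] := pselect (h s = h (k :: s)); first by rewrite -eh; exact: leaf_refl.
have eq_off i : i != k -> coord (h s) i = coord (h (k :: s)) i.
  by move=> ik; rewrite !coordK inE (negPf ik).
have k_first : tag k = i0.
  apply: val_inj; apply/eqP; rewrite -leqn0 leqNgt; apply/negP => k_gt0.
  apply: neh; apply: coord_inj => i; have [->|] := eqVneq i k; last exact: eq_off.
  by rewrite !coordK mem_head; case: ifP => // _; exact: xyc.
apply: leaf_coord => i i_gt0.
exact: (coord_move k_first eq_off neh FK GK).
Qed.

(** The midpoint and the ends of a segment in a leaf; needed for [eta 1 >= 1]. *)
Lemma equidistant_triple :
  exists x p q : X, [/\ x <> p, x <> q, p <> q & D x p = D x q].
Proof.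
pose p : X := fun _ => 0; pose q := push p i0 1.
have Dpq : D p q = 1 by exact: D_push0.
have lpq : leaf p q by exact: leaf_push0.
pose x := segment p q (1 / 2).
have Dxp : D x p = 1 / 2.
  rewrite -(segment0 p q) D_segment // Dpq subr0 mulr1.
  by rewrite ger0_norm ?divr_ge0.
have Dxq : D x q = 1 / 2.
  rewrite -(segment1 p q) D_segment // Dpq mulr1.
  by rewrite distrC ger0_norm; lra.
exists x, p, q; split; last by rewrite Dxq.
- by move=> e; move: Dxp; rewrite e Dxx; lra.
- by move=> e; move: Dxq; rewrite e Dxx; lra.
- by move=> e; move: Dpq; rewrite -e Dxx; lra.
Qed.

End Main.

(** * Homeomorphisms of the half-line *)

Section HalflineHomeo.
Context {R : realType} {eta etainv : R -> R}.
Hypothesis eta_homeo : homeo_halfline eta etainv.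

(** A continuous injection of an interval is strictly monotone; the point where [eta] equals
    [eta 0 + 1] shows that it increases. *)
Lemma homeo_halfline_mono : forall s t, 0 <= s -> 0 <= t -> (eta s <= eta t) = (s <= t).
Proof.
have [eta_ge0 [inv_ge0 etaK invK eta_cont _]] := eta_homeo.
have eta_inj : {in `[0, +oo[ &, injective eta}.
  move=> s t; rewrite !in_itv /= !andbT => s0 t0 st.
  by rewrite -(etaK s) // st etaK.
have z0 : (0 : R) \in `[0, +oo[ by rewrite in_itv /= lexx.
pose t0 := etainv (eta 0 + 1).
have e1 : 0 <= eta 0 + 1 by rewrite addr_ge0 ?eta_ge0.
have t0_ge0 : 0 <= t0 by exact: inv_ge0.
have et0 : eta t0 = eta 0 + 1 by exact: invK.
have t0_gt0 : 0 < t0.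
  rewrite lt_def t0_ge0 andbT; apply/eqP => e.
  by move: et0; rewrite e => /eqP; rewrite -subr_eq0 opprD addNKr oppr_eq0 oner_eq0.
have mono : {in `[0, +oo[ &, {mono eta : x y / x <= y}}.
  apply: itv_continuous_inj_le => //; exists 0, t0; split => //.
    by rewrite in_itv /= t0_ge0.
  by rewrite et0 lerDl.
by move=> s t s0 t0'; apply: mono; rewrite in_itv /= andbT.
Qed.

(** By monotonicity [eta 0] is at most the value [0] taken at [etainv 0], so [etainv t = 0] would
    give [t <= 0]. *)
Lemma homeo_halfline_inv_gt0 t : 0 < t -> 0 < etainv t.
Proof.
have [eta_ge0 [inv_ge0 etaK invK _ _]] := eta_homeo.
move=> t0; rewrite lt_def (inv_ge0 t (ltW t0)) andbT; apply/eqP => e.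
have : eta 0 <= eta (etainv 0) by rewrite homeo_halfline_mono ?inv_ge0.
have := invK t (ltW t0); rewrite e => ->; rewrite invK // => /(lt_le_trans t0).
by rewrite ltxx.
Qed.

End HalflineHomeo.

(** * Multiplicative forms of quasisymmetry for a map and its inverse *)

Section Quasisymmetric.
Context {T : Type} {R : realType} {d : T -> T -> R}.
Context {eta etainv : R -> R} {F G : T -> T}.
Hypotheses (d_ge0 : forall x y, 0 <= d x y) (dxx : forall x, d x x = 0).
Hypothesis d_gt0 : forall x y, x <> y -> 0 < d x y.
Hypothesis eta_homeo : homeo_halfline eta etainv.
Hypotheses (FK : cancel F G) (GK : cancel G F).
Hypothesis F_qs : forall x y z, x <> y -> x <> z -> y <> z ->
  d (F x) (F y) / d (F x) (F z) <= eta (d x y / d x z).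

(** The [1] in the maximum covers [y = z], which the inequality for distinct points leaves out. *)
Lemma quasisym_le l x y z : 0 <= l -> d x y <= l * d x z ->
  d (F x) (F y) <= Num.max 1 (eta l) * d (F x) (F z).
Proof.
move=> l0 le_xyz.
have max1 : 1 <= Num.max 1 (eta l) by rewrite le_max lexx.
have max0 := le_trans ler01 max1.
have [<-|nxy] := pselect (x = y); first by rewrite dxx mulr_ge0.
have [exz|nxz] := pselect (x = z).
  by move: le_xyz; rewrite -exz dxx mulr0 leNgt d_gt0.
have [<-|nyz] := pselect (y = z); first by rewrite ler_peMl.
have dF : 0 < d (F x) (F z) by apply: d_gt0 => /(can_inj FK).
rewrite -ler_pdivrMr //; apply: le_trans (F_qs nxy nxz nyz) _.
rewrite le_max (homeo_halfline_mono eta_homeo) ?divr_ge0 //.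
by rewrite ler_pdivrMr ?d_gt0 // le_xyz orbT.
Qed.

(** Apply quasisymmetry of [F] at [G x] with the other two points exchanged, then undo [eta] by
    monotonicity. *)
Lemma quasisym_inv_le l x y z : 0 < l -> d x y <= l * d x z ->
  d (G x) (G y) <= Num.max 1 (etainv l^-1)^-1 * d (G x) (G z).
Proof.
have [eta_ge0 [inv_ge0 etaK invK _ _]] := eta_homeo.
move=> l0 le_xyz.
have max1 : 1 <= Num.max 1 (etainv l^-1)^-1 by rewrite le_max lexx.
have max0 := le_trans ler01 max1.
have G_inj := can_inj GK.
have [<-|nxy] := pselect (x = y); first by rewrite dxx mulr_ge0.
have [exz|nxz] := pselect (x = z).
  by move: le_xyz; rewrite -exz dxx mulr0 leNgt d_gt0.
have [<-|nyz] := pselect (y = z); first by rewrite ler_peMl.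
have dGy : 0 < d (G x) (G y) by apply: d_gt0 => /G_inj.
have dGz : 0 < d (G x) (G z) by apply: d_gt0 => /G_inj.
have dy := d_gt0 nxy; have dz := d_gt0 nxz.
have h : d x z / d x y <= eta (d (G x) (G z) / d (G x) (G y)).
  by have := @F_qs (G x) (G z) (G y); rewrite !GK; apply=> /G_inj // /esym.
have lV0 : 0 < l^-1 by rewrite invr_gt0.
have iV0 : 0 < etainv l^-1 := homeo_halfline_inv_gt0 eta_homeo lV0.
have : eta (etainv l^-1) <= eta (d (G x) (G z) / d (G x) (G y)).
  apply: le_trans h; rewrite invK ?(ltW lV0) // ler_pdivlMr // ler_pdivrMl //.
rewrite (homeo_halfline_mono eta_homeo) ?divr_ge0 ?(ltW iV0) // => h'.
apply: le_trans (_ : (etainv l^-1)^-1 * d (G x) (G z) <= _); last first.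
  by rewrite ler_wpM2r // le_max lexx orbT.
by rewrite ler_pdivlMl // -ler_pdivlMr.
Qed.

End Quasisymmetric.

(** * The explicit quasisimilarity constant *)

Theorem theorem4p1 (R : realType) (r : nat) (ns : nat -> nat) (alpha : nat -> R)
  (eta etainv : R -> R) (F : Pt R r ns -> Pt R r ns) :
  (2 <= r)%N ->
  (forall i, (i < r)%N -> (1 <= ns i)%N) ->
  0 < alpha 0%N ->
  (forall i j, (i < j)%N -> (j < r)%N -> alpha i < alpha j) ->
  homeo_halfline eta etainv ->
  quasisym (Dmet alpha) eta F ->
  exists2 C : R, 0 < C &
    quasisim (Dmet alpha) ((eta 1 / etainv 1) ^+ (2 * r + 2)) C F.
Proof.
move=> r_ge2 ns_ge1 alpha0 alpha_incr eta_homeo; rewrite -distE.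
move=> [[G [FK GK F_cont G_cont]] F_qs].
have [eta_ge0 [inv_ge0 etaK invK _ _]] := eta_homeo.
have d_ge0 := @D_ge0 R r ns alpha.
have dxx := Dxx (ns := ns) alpha0 alpha_incr.
have d_gt0 := D_gt0 (ns := ns) alpha0 alpha_incr.
have qF := quasisym_le d_ge0 dxx d_gt0 eta_homeo FK F_qs.
have qG := quasisym_inv_le d_ge0 dxx d_gt0 eta_homeo GK F_qs.
have rough_F : rough_qs (alpha := alpha) F.
  move=> l l0; exists (Num.max 1 (eta l)); first by rewrite lt_max ltr01.
  by move=> x y z; apply: qF; exact: ltW.
have rough_G : rough_qs (alpha := alpha) G.
  move=> l l0; exists (Num.max 1 (etainv l^-1)^-1); first by rewrite lt_max ltr01.
  by move=> x y z; apply: qG.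
have F_leaf := rough_qs_leaf_map r_ge2 alpha0 alpha_incr FK GK F_cont rough_F.
have G_leaf := rough_qs_leaf_map r_ge2 alpha0 alpha_incr GK FK G_cont rough_G.
(* For an equidistant triple, [eta 1] bounds a ratio of image distances and also its inverse. *)
have eta1 : 1 <= eta 1.
  have [x [p [q [nxp nxq npq Dx]]]] :=
    equidistant_triple r_ge2 ns_ge1 alpha0 alpha_incr.
  have F_inj := can_inj FK.
  have Fp : 0 < dist (alpha := alpha) (F x) (F p) by apply: d_gt0 => /F_inj.
  have Fq : 0 < dist (alpha := alpha) (F x) (F q) by apply: d_gt0 => /F_inj.
  have h1 := F_qs x p q nxp nxq npq; have h2 := F_qs x q p nxq nxp (nesym npq).
  rewrite Dx divff ?gt_eqF ?d_gt0 // in h1; rewrite Dx divff ?gt_eqF ?d_gt0 // in h2.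
  rewrite ler_pdivrMr // in h1; rewrite ler_pdivrMr // in h2.
  rewrite leNgt; apply/negP => lt1; nra.
have inv1_gt0 : 0 < etainv 1 by exact: (homeo_halfline_inv_gt0 eta_homeo).
have inv1_le1 : etainv 1 <= 1.
  by rewrite -(homeo_halfline_mono eta_homeo) ?invK // ltW.
have H'_ge1 : 1 <= (etainv 1)^-1 by rewrite invf_ge1.
have F_weak : weak_qs (alpha := alpha) (eta 1) F.
  move=> x y z xyz; have := qF 1 x y z ler01; rewrite mul1r => /(_ xyz).
  by rewrite max_r.
have G_weak : weak_qs (alpha := alpha) (etainv 1)^-1 G.
  move=> x y z xyz; have := qG 1 x y z ltr01; rewrite mul1r => /(_ xyz).
  by rewrite invr1 max_r.
rewrite distE.
apply: (leaf_map_quasisim r_ge2 ns_ge1 alpha0 alpha_incr eta1 H'_ge1 FK GK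
  F_leaf G_leaf F_weak G_weak).
(* The exponents obtained are [4] and [3]; [2 * r + 2 >= 6] exceeds both, and the two bases are at
   least one. *)
have le6 : (6 <= 2 * r + 2)%N by rewrite -[6%N]/(2 * 2 + 2)%N leq_add2r leq_mul2l.
rewrite exprMn; apply: ler_pM.
- exact: exprn_ge0 (le_trans ler01 eta1).
- exact: exprn_ge0 (le_trans ler01 H'_ge1).
- by apply: ler_weXn2l => //; exact: leq_trans le6.
- by apply: ler_weXn2l => //; exact: leq_trans le6.
Qed.
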